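(* Let $0<\varepsilon\le 1$ be such that $\ln\frac{1+\varepsilon}{\varepsilon}$ is an integer, and let $m=i\cdot\ln\frac{1+\varepsilon}{\varepsilon}$ for some positive integer $i$. Then for the problem $P_m|\varepsilon,\mathrm{online}|\sum p_j(1-U_j)$ (online maximization of total accepted processing time on $m$ parallel identical machines, without preemption, with immediate and irrevocable acceptance and allocation decisions, and slack factor $\varepsilon$) there is a deterministic online algorithm with strict competitive ratio at most $$e\cdot\ln\left(\frac{1+\varepsilon}{\varepsilon}\right)+1.$$
   Context: Problem. There are $m$ parallel identical machines and a finite sequence $\mathcal{J}$ of jobs. Job $J_j$ has release (submission) date $r_j\ge 0$, processing time $p_j>0$ and deadline $d_j$ satisfying the slack condition $d_j-r_j\ge(1+\varepsilon)p_j$. The sequence is ordered so that $J_i$ precedes $J_j$ whenever $r_i<r_j$ (several jobs may have the same release date). Jobs are revealed in sequence order; job $J_j$ becomes known at time $r_j$, and the online algorithm must decide immediately, before seeing any later job of the sequence, whether to accept it ($U_j=0$) or reject it ($U_j=1$). If it accepts the job it must also immediately and irrevocably fix the machine and the starting time of the job. An accepted job is processed without interruption on a single machine, starting no earlier than $r_j$ and completing no later than $d_j$; a machine processes at most one job at a time. The objective is to maximize $\sum_j p_j(1-U_j)$. Let $\mathrm{ALG}(\mathcal{J})$ be the objective value of the online algorithm and $\mathrm{OPT}(\mathcal{J})$ the optimal offline value, i.e. the maximum total processing time of a subset of the jobs of $\mathcal{J}$ that has a non-preemptive schedule on $m$ machines in which every job of the subset is processed between its release date and its deadline. The algorithm has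 strict competitive ratio (at most) $c$ if $\mathrm{OPT}(\mathcal{J})\le c\cdot\mathrm{ALG}(\mathcal{J})$ for every job sequence $\mathcal{J}$ satisfying the slack condition. Here $e$ is Euler's number. *)

(* Defs.v *)
From HB Require Import structures.
From mathcomp Require Import all_boot all_order all_algebra.
From mathcomp Require Import boolp reals.

Set Implicit Arguments.
Unset Strict Implicit.
Unset Printing Implicit Defensive.

Import Order.TTheory GRing.Theory Num.Theory.
Local Open Scope ring_scope.

Record job (R : realType) := Job { release : R; proc : R; deadline : R }.

Definition job_at (R : realType) (J : seq (job R)) (j : 'I_(size J)) : job R :=
  tnth (in_tuple J) j.

(* Jobs with equal release dates may be listed in any order. *)
Definition valid_instance (R : realType) (eps : R) (J : seq (job R)) : Prop :=
  (forall j : 'I_(size J),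
     [/\ 0 <= release (job_at j), 0 < proc (job_at j) &
         (1 + eps) * proc (job_at j)
           <= deadline (job_at j) - release (job_at j)]) /\
  (forall i j : 'I_(size J),
     release (job_at i) < release (job_at j) -> (i < j)%N).

(* [None] rejects the job; [Some (k, t)] runs it on machine k without
   interruption during the half-open interval from t to t + p. *)
Definition decision (R : realType) (m : nat) := option ('I_m * R).

Definition schedule (R : realType) (m : nat) (J : seq (job R)) :=
  'I_(size J) -> decision R m.

Definition processing (R : realType) (m : nat) (J : seq (job R))
    (S : schedule m J) (j : 'I_(size J)) (k : 'I_m) (x : R) : Prop :=
  exists2 t : R, S j = Some (k, t) & t <= x < t + proc (job_at j).

Definition feasible (R : realType) (m : nat) (J : seq (job R))
    (S : schedule m J) : Prop :=
  (forall (j : 'I_(size J)) (k : 'I_m) (t : R), S j = Some (k, t) ->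
     release (job_at j) <= t /\ t + proc (job_at j) <= deadline (job_at j)) /\
  (forall (k : 'I_m) (x : R) (i j : 'I_(size J)),
     processing S i k x -> processing S j k x -> i = j).

(* The indicator U_j. *)
Definition rejected (R : realType) (m : nat) (J : seq (job R))
    (S : schedule m J) (j : 'I_(size J)) : bool := ~~ isSome (S j).

Definition objective (R : realType) (m : nat) (J : seq (job R))
    (S : schedule m J) : R :=
  \sum_(j < size J) proc (job_at j) * (1 - (rejected S j)%:R).

Definition schedulable (R : realType) (m : nat) (J : seq (job R))
    (A : {set 'I_(size J)}) : Prop :=
  exists S : schedule m J,
    feasible S /\ forall j : 'I_(size J), (j \in A) = ~~ rejected S j.

(* The default value 0 of the maximum is the value of the empty subset,
   which is always schedulable. *)
Definition OPT (R : realType) (m : nat) (J : seq (job R)) : R :=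
  \big[Order.max/0]_(A : {set 'I_(size J)} | `[< schedulable m A >])
    \sum_(j in A) proc (job_at j).

(* A decision is a function of the jobs already revealed and the current job;
   the earlier decisions are themselves determined by the earlier jobs. *)
Definition online_rule (R : realType) (m : nat) :=
  seq (job R) -> job R -> decision R m.

Definition run (R : realType) (m : nat) (A : online_rule R m)
    (J : seq (job R)) : schedule m J :=
  fun j => A (take j J) (job_at j).
Arguments run {R m} A J j.

Definition online_algorithm (R : realType) (m : nat) (eps : R)
    (A : online_rule R m) : Prop :=
  forall J : seq (job R), valid_instance eps J -> feasible (run A J).

Definition ALG (R : realType) (m : nat) (A : online_rule R m)
    (J : seq (job R)) : R := objective (run A J).

Definition strict_competitive_ratio_le (R : realType) (m : nat) (eps : R)
    (A : online_rule R m) (c : R) : Prop :=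
  forall J : seq (job R), valid_instance eps J -> OPT m J <= c * ALG A J.

(* Main.v *)
Require Import Defs.
From mathcomp Require Import all_boot all_order all_algebra.
From mathcomp Require Import boolp reals sequences exp.
From mathcomp Require Import ring lra.

Import Order.TTheory GRing.Theory Num.Theory.
Local Open Scope ring_scope.

(* Write k = ln ((1 + eps) / eps), so that e ^ k = (1 + eps) / eps, and split the
   machines into i groups of k machines. The load S of a group at time t is the
   processing time committed to it and still to be done. A group takes a job if
   d - r >= e * S and then runs it on the most loaded machine of the group on
   which it meets its deadline; a job is rejected if no group takes it.

   If the job does not fit on a machine of load l, then p + l > d - r >= e * S.
   So each time a job goes to a less loaded machine, the total load exceeds e
   times the earlier one. It follows that the sum of the a largest loads of a
   group is at least e ^ (a - 1) times the a-th largest one. For a = k this gives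
   d - r >= e ^ k * (least load), so by the slack condition a job that passes the
   test fits on the least loaded machine.

   A job rejected at time r has d < r + e * S, where t + e * S(t) does not
   increase while S > 0, except by e * p when the group takes a job. Hence one
   machine of the optimal schedule can spend at most e * V on rejected jobs,
   V being the processing time accepted by the group. Summing over the i * k
   machines and averaging over the i groups, the rejected jobs contribute at most
   k * e * ALG to OPT, and the accepted ones at most ALG. *)

(** * Work done on disjoint intervals *)

(** A summand is the length of the part of [a i, b i] before the given time, and disjoint intervals
    cover at most y - x of [x, y]. *)
Lemma disjoint_work_lipschitz {R : realType} {I : eqType} (a b : I -> R)
    (s : seq I) (x y : R) :
  uniq s -> {in s, forall i, a i <= b i} ->
  {in s &, forall i j, i != j -> b i <= a j \/ b j <= a i} ->
  x <= y ->
  \sum_(i <- s) (Num.min (b i) y - Num.min (a i) y)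
    <= \sum_(i <- s) (Num.min (b i) x - Num.min (a i) x) + (y - x).
Proof.
elim: s x y => [|j s IH] x y /=; first by rewrite !big_nil; lra.
move=> /andP[jNs us] leab dis lexy; rewrite !big_cons.
have leab_s : {in s, forall i, a i <= b i}.
  by move=> i si; apply: leab; rewrite in_cons si orbT.
have dis_s : {in s &, forall i i', i != i' -> b i <= a i' \/ b i' <= a i}.
  by move=> i i' si si'; apply: dis; rewrite in_cons ?si ?si' orbT.
have leabj : a j <= b j by apply: leab; rewrite mem_head.
(* The interval of j cuts [x, y] into [x, a'], [a', b'], [b', y]; the other
   intervals do no work in the middle part. *)
pose a' := Num.max x (Num.min (a j) y); pose b' := Num.max x (Num.min (b j) y).
have xa' : x <= a' by rewrite /a' le_max lexx.
have b'y : b' <= y by rewrite /b' ge_max lexy ge_min lexx orbT.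
have a'b' : a' <= b'.
  have lemin : Num.min (a j) y <= Num.min (b j) y.
    by rewrite le_min !ge_min leabj lexx orbT.
  by rewrite /a' /b' ge_max !le_max lexx lemin orbT.
have mid : \sum_(i <- s) (Num.min (b i) a' - Num.min (a i) a')
         = \sum_(i <- s) (Num.min (b i) b' - Num.min (a i) b').
  rewrite !big_seq; apply: eq_bigr => i si.
  have leabi : a i <= b i by exact: leab_s.
  have ij : i != j by apply: contraNneq jNs => <-.
  (* A middle part of positive length lies inside the interval of j, so the interval of i misses
     it. *)
  have [<- //|ltab'] := eqVneq a' b'.
  have {}ltab' : a' < b' by rewrite lt_neqAle ltab' a'b'.
  have aja' : a j <= a'.
    move: ltab'; rewrite /a' /b' le_max; case: (leP (a j) y) => //= [_|ltya].
      by rewrite lexx orbT.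
    by rewrite (min_r (ltW (lt_le_trans ltya leabj))) ltxx.
  have b'bj : b' <= b j.
    have : x < b' by exact: le_lt_trans xa' ltab'.
    rewrite /b'; case: (leP x (Num.min (b j) y)) => [|_]; last by rewrite ltxx.
    by rewrite ge_min lexx.
  have [leba|leba] := dis i j (mem_behead (s := j :: s) si) (mem_head j s) ij.
    by rewrite !min_l//; lra.
  by rewrite !min_r//; lra.
have own : Num.min (b j) y - Num.min (a j) y
         = Num.min (b j) x - Num.min (a j) x + (b' - a').
  have clampE u : Num.max x (Num.min u y) = x + (Num.min u y - Num.min u x).
    case: (leP u x) => [lux|ltxu].
      by rewrite (min_l (le_trans lux lexy)) max_l//; lra.
    by rewrite max_r ?le_min ?(ltW ltxu)//; lra.
  by rewrite /a' /b' !clampE; lra.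
have := IH x a' us leab_s dis_s xa'.
have := IH b' y us leab_s dis_s b'y.
rewrite mid own; lra.
Qed.

(** * Load of a group and its geometric balance *)

Definition load {R : realType} {T : finType} (G : {set T}) (C : T -> R)
    (t : R) : R :=
  \sum_(k in G) (Num.max t (C k) - t).

Lemma load_ge0 {R : realType} {T : finType} (G : {set T}) (C : T -> R) t :
  0 <= load G C t.
Proof. by apply: sumr_ge0 => k _; rewrite subr_ge0 le_max lexx. Qed.

(** A positive load at t' needs a machine with [C k > t']; its own load falls by exactly t' - t, and
    no other load grows. *)
Lemma load_decay {R : realType} {T : finType} (G : {set T}) (C : T -> R) t t' :
  t <= t' -> 0 < load G C t' -> load G C t' + (t' - t) <= load G C t.
Proof.
move=> le_tt' pos.
have /existsP[k /andP[kG ltk]] : [exists k, (k \in G) && (t' < C k)].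
  apply: contraLR pos => /existsPn noG; rewrite -leNgt.
  apply: sumr_le0 => k kG; have := noG k; rewrite kG /= -leNgt => leC.
  by rewrite (max_l leC) subrr.
rewrite /load (bigD1 k)//= [leRHS](bigD1 k)//=.
rewrite (max_r (ltW ltk)) (max_r (le_trans le_tt' (ltW ltk))).
suff: \sum_(j in G | j != k) (Num.max t' (C j) - t')
  <= \sum_(j in G | j != k) (Num.max t (C j) - t) by lra.
apply: ler_sum => j _.
by case: (leP t' (C j)) => ?; case: (leP t (C j)) => ?; lra.
Qed.

(** Thresholds [w] replace a sorting of the machines: [A] holds those of largest completion time,
    and [w - t] is at most each of their loads. *)
Definition balanced {R : realType} {T : finType} (q : R) (G : {set T})
    (C : T -> R) (t : R) : Prop :=
  forall w, t < w -> forall A, A = [set k in G | w <= C k] -> A != set0 ->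
    q ^+ #|A|.-1 * (w - t) <= \sum_(k in A) (C k - t).

(** Compares the rates at which the two sides of [balanced] fall; at n = 0 the truncated predecessor
    makes it 0 <= 1. *)
Lemma natr_le_exp {R : realType} (q : R) n : 2 <= q -> n%:R <= q ^+ n.-1.
Proof.
move=> q2; case: n => [|n]; first by rewrite expr0 ler01.
elim: n => [|n IH] /=; first by rewrite expr0.
move: IH => /=; rewrite exprS -!(natr1 n.+1) => IH.
have : q ^+ n >= 1 by rewrite exprn_ege1//; lra.
nra.
Qed.

(* As time passes, the left side drops at rate q ^ (#|A| - 1) and the right
   side only at rate #|A|. *)
Lemma balanced_decay {R : realType} {T : finType} (q : R) (G : {set T})
    (C : T -> R) t t' :
  2 <= q -> t <= t' -> balanced q G C t -> balanced q G C t'.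
Proof.
move=> q2 le_tt' bal w ltw A defA A0.
have := bal w (le_lt_trans le_tt' ltw) A defA A0.
have -> : \sum_(k in A) (C k - t) = \sum_(k in A) (C k - t') + #|A|%:R * (t' - t).
  rewrite mulr_natl -sumr_const -big_split /=.
  by apply: eq_bigr => k _; lra.
have := natr_le_exp q #|A| q2; nra.
Qed.

Lemma sum_le_load {R : realType} {T : finType} (G A : {set T}) (C : T -> R) t :
  A \subset G -> \sum_(k in A) (C k - t) <= load G C t.
Proof.
move=> AG; apply: (@le_trans _ _ (\sum_(k in A) (Num.max t (C k) - t))).
  by apply: ler_sum => k _; rewrite lerB// le_max lexx orbT.
rewrite /load [leRHS](big_setID A)/= (setIidPr AG) lerDl.
by apply: sumr_ge0 => k _; rewrite subr_ge0 le_max lexx.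
Qed.

Lemma exists_least_loaded {R : realType} {T : finType} (q : R) (G : {set T})
    (C : T -> R) t :
  0 <= q -> G != set0 -> balanced q G C t ->
  exists2 k, k \in G &
    q ^+ #|G| * (Num.max t (C k) - t) <= q * load G C t.
Proof.
move=> q0 /set0Pn[k0 k0G] bal.
case: (@arg_minP _ _ _ k0 (mem G) C k0G) => k kG kmin.
exists k => //; case: (leP t (C k)) => [|ltC]; last first.
  by rewrite subrr mulr0 mulr_ge0// load_ge0.
rewrite le_eqVlt => /predU1P[<-|ltC].
  by rewrite subrr mulr0 mulr_ge0// load_ge0.
(* The least completion time, taken as threshold, selects the whole group. *)
have defG : G = [set j in G | C k <= C j].
  apply/setP => j; rewrite inE; case jG: (j \in G) => //=.
  by rewrite kmin.
have G0 : G != set0 by apply/set0Pn; exists k0.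
have := bal (C k) ltC G defG G0.
have := sum_le_load G G C t (subxx _).
have /prednK <- : (0 < #|G|)%N by rewrite card_gt0.
rewrite [in X in _ -> _ -> X]/= exprS => H1 H2.
by rewrite -mulrA ler_wpM2l// (le_trans H2).
Qed.

(* A machine of A would not have had room for the job, so
   p + C k1 - t > d >= q * load. *)
Lemma balanced_insert {R : realType} {T : finType} (q : R) (G : {set T})
    (C : T -> R) (t p d : R) (k : T) :
  0 <= q -> 0 < p -> balanced q G C t -> q * load G C t <= d ->
  {in G, forall k', C k < C k' -> d < Num.max t (C k') - t + p} ->
  balanced q G (fun k' => if k' == k then Num.max t (C k) + p else C k') t.
Proof.
move=> q0 p0 bal ld best w ltw A' defA' A'0.
pose A := [set k' in G | w <= C k'].
have leC k' : C k' <= (if k' == k then Num.max t (C k) + p else C k').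
  case: eqP => [->|//]; case: (leP t (C k)); lra.
have sumle : \sum_(j in A) (C j - t) <=
    \sum_(j in A) ((if j == k then Num.max t (C k) + p else C j) - t).
  by apply: ler_sum => j _; rewrite lerB.
have AA' : A \subset A'.
  apply/subsetP => j; rewrite defA' !inE => /andP[-> wj] /=.
  exact: le_trans (leC j).
(* Only a machine k that rises above the threshold enlarges the set; otherwise the old bound and the
   larger sum suffice. *)
case: (boolP (k \in A')) => [kA'|kNA']; last first.
  have eqA : A' = A.
    apply/eqP; rewrite eqEsubset AA' andbT; apply/subsetP => j jA'.
    move: (jA'); rewrite defA' !inE; case: eqP => // jk.
    by rewrite jk in jA'; rewrite jA' in kNA'.
  rewrite eqA in A'0 *; exact: le_trans (bal w ltw A erefl A'0) sumle.
case: (boolP (k \in A)) => [kA|kNA].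
  have eqA : A' = A.
    apply/eqP; rewrite eqEsubset AA' andbT; apply/subsetP => j.
    by have [-> //|jk] := eqVneq j k; rewrite defA' !inE (negPf jk).
  rewrite eqA in A'0 *; exact: le_trans (bal w ltw A erefl A'0) sumle.
have eqA : A' = k |: A.
  apply/setP => j; rewrite in_setU1; have [->|jk] := eqVneq j k; first by [].
  by rewrite defA' !inE (negPf jk).
have kG : k \in G by move: kA'; rewrite defA' inE => /andP[].
have wk : w <= Num.max t (C k) + p.
  by move: kA'; rewrite defA' inE eqxx => /andP[].
have Ckw : C k < w by move: kNA; rewrite inE kG /= -ltNge.
rewrite eqA cardsU1 kNA add1n /= big_setU1//= eqxx.
have [A0|A0] := eqVneq A set0.
  by rewrite A0 cards0 big_set0 expr0; lra.
have := bal w ltw A erefl A0.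
have /set0Pn[k1 k1A] := A0.
have /andP[k1G wk1] : (k1 \in G) && (w <= C k1) by move: k1A; rewrite inE.
have := best k1 k1G (lt_le_trans Ckw wk1).
have /prednK eA : (0 < #|A|)%N by rewrite card_gt0.
rewrite -[in X in _ -> _ -> X]eA exprS => fit1 balA.
have AG : A \subset G by apply/subsetP => j; rewrite inE => /andP[].
have leload := sum_le_load G A C t AG.
(* The new load of k is at least p; together with [C k1 - t] from the sum over [A] this exceeds
   d. *)
have : C k1 - t <= \sum_(j in A) ((if j == k then Num.max t (C k) + p else C j) - t).
  rewrite (bigD1 k1)//=; have [k1k|_] := eqVneq k1 k.
    by rewrite -k1k k1A in kNA.
  rewrite lerDl sumr_ge0// => j /andP[]; rewrite inE => /andP[_ wj] _.
  by rewrite subr_ge0 (le_trans (ltW ltw))// (le_trans wj).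
rewrite -mulrA => sum1.
have := ler_wpM2l q0 (le_trans balA leload).
move: fit1; rewrite (max_r (ltW (lt_le_trans ltw wk1))).
have : t <= Num.max t (C k) by rewrite le_max lexx.
lra.
Qed.

(** * The best-fit algorithm *)

Definition fits {R : realType} {m : nat} (C : 'I_m -> R) (x : job R)
    (k : 'I_m) : bool :=
  Num.max (release x) (C k) + proc x <= deadline x.

Definition group {m i : nat} (grp : 'I_m -> 'I_i) (g : 'I_i) : {set 'I_m} :=
  [set k | grp k == g].

(* [C k] is the completion time of the last job committed to machine k. *)
Definition place {R : realType} {m i : nat} (q : R) (grp : 'I_m -> 'I_i)
    (C : 'I_m -> R) (x : job R) : option 'I_m :=
  [pick k | [&& q * load (group grp (grp k)) C (release x)
                  <= deadline x - release x,
                fits C x k &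
                [forall k', (grp k' == grp k) && fits C x k'
                              ==> (C k' <= C k)]]].

Definition assign {R : realType} {m : nat} (C : 'I_m -> R) (x : job R)
    (k : 'I_m) : 'I_m -> R :=
  fun k' => if k' == k then Num.max (release x) (C k) + proc x else C k'.

Definition update {R : realType} {m i : nat} (q : R) (grp : 'I_m -> 'I_i)
    (C : 'I_m -> R) (x : job R) : 'I_m -> R :=
  if place q grp C x is Some k then assign C x k else C.

(** An online rule carries no state, so the completion times are replayed from the revealed jobs. *)
Definition completion {R : realType} {m i : nat} (q : R) (grp : 'I_m -> 'I_i)
    (s : seq (job R)) : 'I_m -> R :=
  foldl (update q grp) (fun=> 0) s.

Definition best_fit_rule {R : realType} {m i : nat} (q : R)
    (grp : 'I_m -> 'I_i) : online_rule R m :=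
  fun s x => let C := completion q grp s in
    omap (fun k => (k, Num.max (release x) (C k))) (place q grp C x).

Lemma place_Some {R : realType} {m i : nat} (q : R) (grp : 'I_m -> 'I_i) C x k :
  place q grp C x = Some k ->
  [/\ q * load (group grp (grp k)) C (release x) <= deadline x - release x,
      fits C x k &
      forall k', grp k' = grp k -> C k < C k' -> ~~ fits C x k'].
Proof.
rewrite /place; case: pickP => // j /and3P[ld fit /forallP best] [<-].
split=> // k' gk' lt; apply/negP => fit'.
by have := best k'; rewrite gk' eqxx fit' /= leNgt lt.
Qed.

(** If g passed the load test, its least loaded machine would have room, so a most loaded machine
    with room would qualify for the pick. *)
Lemma place_None {R : realType} {m i : nat} (eps q : R) (grp : 'I_m -> 'I_i)
    C x g :
  0 < eps -> 0 <= q -> (1 + eps) / eps <= q ^+ #|group grp g| ->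
  (1 + eps) * proc x <= deadline x - release x ->
  group grp g != set0 -> balanced q (group grp g) C (release x) ->
  place q grp C x = None ->
  deadline x - release x < q * load (group grp g) C (release x).
Proof.
move=> eps0 q0 qk slack gN0 bal; rewrite /place; case: pickP => // nopick _.
rewrite ltNge; apply/negP => ld.
have [k0 k0g least] := exists_least_loaded q (group grp g) C _ q0 gN0 bal.
have fit0 : fits C x k0.
  rewrite /fits.
  have l0 : 0 <= Num.max (release x) (C k0) - release x.
    by rewrite subr_ge0 le_max lexx.
  move: l0 least; set l := Num.max _ _ - _ => l0 least.
  have : (1 + eps) / eps * l <= deadline x - release x.
    by apply: le_trans ld; apply: le_trans least; rewrite ler_wpM2r.
  rewrite mulrAC ler_pdivrMr// => le1.
  have -> : Num.max (release x) (C k0) = release x + l by rewrite /l; lra.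
  (* With D = d - r, add (1 + eps) * l <= eps * D and the slack condition (1 + eps) * p <= D. *)
  rewrite -(@ler_pM2l _ (1 + eps)); last by lra.
  nra.
pose P k := (k \in group grp g) && fits C x k.
have Pk0 : P k0 by rewrite /P k0g.
case: (@arg_maxP _ _ _ k0 P C Pk0) => k /andP[kg fitk] kmax.
have gk : grp k = g by apply/eqP; move: kg; rewrite inE.
have := nopick k; rewrite gk ld fitk /= => /negP; apply.
by apply/forallP => k'; apply/implyP => /andP[gk' ?]; apply: kmax; rewrite /P inE gk'.
Qed.

Lemma load_assign {R : realType} {m i : nat} (grp : 'I_m -> 'I_i)
    (C : 'I_m -> R) x k g :
  0 <= proc x ->
  load (group grp g) (assign C x k) (release x)
    = load (group grp g) C (release x) + (if grp k == g then proc x else 0).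
Proof.
move=> p0; rewrite /load /assign; case: ifP => kg.
  have kG : k \in group grp g by rewrite inE.
  rewrite (bigD1 k)//= [in RHS](bigD1 k)//= eqxx.
  have -> : \sum_(j in group grp g | j != k)
    (Num.max (release x) (if j == k then Num.max (release x) (C k) + proc x
                          else C j) - release x)
    = \sum_(j in group grp g | j != k) (Num.max (release x) (C j) - release x).
    by apply: eq_bigr => j /andP[_ /negPf ->].
  rewrite max_r; first by lra.
  by case: (leP (release x) (C k)); lra.
rewrite addr0; apply: eq_bigr => j; rewrite inE.
by have [->|//] := eqVneq j k; rewrite kg.
Qed.

Lemma update_mono {R : realType} {m i : nat} (q : R) (grp : 'I_m -> 'I_i)
    (C : 'I_m -> R) x k : 0 <= proc x -> C k <= update q grp C x k.
Proof.
move=> p0; rewrite /update /assign; case: place => // k'; case: eqP => // ->.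
by case: (leP (release x) (C k')); lra.
Qed.

Lemma balanced_update {R : realType} {m i : nat} (q : R) (grp : 'I_m -> 'I_i)
    (C : 'I_m -> R) x g :
  0 <= q -> 0 < proc x -> balanced q (group grp g) C (release x) ->
  balanced q (group grp g) (update q grp C x) (release x).
Proof.
move=> q0 p0 bal; rewrite /update; case E: place => [k|//].
have [ld fit best] := place_Some q grp C x k E.
have [gk|gk] := eqVneq (grp k) g; last first.
  move=> w ltw A defA A0.
  have nek j : j \in group grp g -> j != k.
    by rewrite inE => /eqP gj; apply: contraNneq gk => <-; rewrite gj.
  have defA' : A = [set j in group grp g | w <= C j].
    rewrite defA; apply/setP => j; rewrite !inE /assign.
    by have [->|//] := eqVneq j k; rewrite (negPf gk).
  have -> : \sum_(j in A) (assign C x k j - release x)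
          = \sum_(j in A) (C j - release x).
    apply: eq_bigr => j; rewrite defA' inE => /andP[/nek /negPf jk _].
    by rewrite /assign jk.
  exact: bal w ltw A defA' A0.
rewrite gk in ld best.
apply: (balanced_insert _ _ _ _ _ _ _ q0 p0 bal ld) => k'.
rewrite inE => /eqP gk' /(best k' gk'); rewrite /fits -ltNge; lra.
Qed.

(** * Feasibility and balance along a run *)

Lemma completion_take {R : realType} {m i : nat} (q : R) (grp : 'I_m -> 'I_i)
    (J : seq (job R)) (j : 'I_(size J)) :
  completion q grp (take j.+1 J)
    = update q grp (completion q grp (take j J)) (job_at j).
Proof.
rewrite /completion (take_nth (job_at j)) ?ltn_ord// foldl_rcons.
by congr update; rewrite [RHS](tnth_nth (job_at j)).
Qed.

Lemma completion_mono {R : realType} {m i : nat} (q : R) (grp : 'I_m -> 'I_i)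
    (J : seq (job R)) (n n' : nat) k :
  (forall j : 'I_(size J), 0 < proc (job_at j)) ->
  (n <= n' <= size J)%N ->
  completion q grp (take n J) k <= completion q grp (take n' J) k.
Proof.
move=> p0; elim: n' => [|n' IH] /andP[nn' n'J].
  by move: nn'; rewrite leqn0 => /eqP ->.
move: nn'; rewrite leq_eqVlt => /predU1P[->//|nn'].
apply: (le_trans (IH _)); first by rewrite -ltnS nn' ltnW.
by rewrite (completion_take q grp J (Ordinal n'J)) update_mono// ltW.
Qed.

Lemma run_Some {R : realType} {m i : nat} (q : R) (grp : 'I_m -> 'I_i)
    (J : seq (job R)) (j : 'I_(size J)) k t :
  run (best_fit_rule q grp) J j = Some (k, t) ->
  place q grp (completion q grp (take j J)) (job_at j) = Some k /\
  t = Num.max (release (job_at j)) (completion q grp (take j J) k).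
Proof. by rewrite /run /best_fit_rule; case: place => //= k' [-> <-]. Qed.

(** Completion times never decrease, so a later job on a machine starts only after the earlier one
    has ended. *)
Lemma best_fit_online {R : realType} {m i : nat} (eps q : R)
    (grp : 'I_m -> 'I_i) : online_algorithm eps (best_fit_rule q grp).
Proof.
move=> J [valid ordered]; split.
  move=> j k t /run_Some[/place_Some[_ fit _] ->].
  by rewrite le_max lexx; split.
have p0 (j : 'I_(size J)) : 0 < proc (job_at j) by have [] := valid j.
have disj k x (j j' : 'I_(size J)) :
    processing (run (best_fit_rule q grp) J) j k x ->
    processing (run (best_fit_rule q grp) J) j' k x -> ~ (j < j')%N.
  move=> [t /run_Some[pk ->] /andP[_ lt]] [t' /run_Some[_ ->] /andP[le _]] jj'.
  have := completion_mono q grp J j.+1 j' k p0.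
  rewrite jj' (ltnW (ltn_ord j')) => /(_ isT).
  rewrite completion_take /update pk /assign eqxx => leC.
  move: le; rewrite ge_max => /andP[_ le].
  by have := lt_le_trans lt (le_trans leC le); rewrite ltxx.
move=> k x j j' pj pj'.
case: (ltngtP j j') => [jj'|jj'|]; last exact: ord_inj.
  by case: (disj k x j j' pj pj' jj').
by case: (disj k x j' j pj' pj jj').
Qed.

Lemma release_mono {R : realType} (eps : R) (J : seq (job R))
    (j j' : 'I_(size J)) :
  valid_instance eps J -> (j < j')%N ->
  release (job_at j) <= release (job_at j').
Proof.
move=> [_ ordered] jj'; rewrite leNgt; apply/negP => /ordered.
by rewrite ltnNge ltnW.
Qed.

(** Each induction step inserts the last job at its release date and then lets time pass to t; the
    ordering of the jobs makes the induction hypothesis available at that date. *)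
Lemma balanced_completion {R : realType} {m i : nat} (eps q : R)
    (grp : 'I_m -> 'I_i) (J : seq (job R)) g n t :
  2 <= q -> valid_instance eps J -> (n <= size J)%N -> 0 <= t ->
  (forall j : 'I_(size J), (j < n)%N -> release (job_at j) <= t) ->
  balanced q (group grp g) (completion q grp (take n J)) t.
Proof.
move=> q2 valid; elim: n t => [|n IH] t nJ t0 rt.
  (* Before any job all completion times are 0 <= t, so no machine reaches a threshold above t. *)
  rewrite take0 => w ltw A -> /set0Pn[k]; rewrite inE => /andP[_ wC].
  have w0 : w <= 0 := wC.
  by have := lt_le_trans (le_lt_trans t0 ltw) w0; rewrite ltxx.
pose j := Ordinal nJ.
have [r0 p0 _] := valid.1 j.
apply: (balanced_decay _ _ _ (release (job_at j))) => //; first exact: rt.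
rewrite (completion_take q grp J j); apply: balanced_update => //; first lra.
by apply: IH => // [|j' j'n]; [exact: ltnW | exact: (release_mono eps)].
Qed.

(** * The potential argument *)

Lemma sum_ord_ltnS {V : nmodType} {N : nat} (P : pred 'I_N) (E : 'I_N -> V)
    (j : 'I_N) :
  \sum_(h < N | (h < j.+1)%N && P h) E h
    = \sum_(h < N | (h < j)%N && P h) E h + (if P j then E j else 0).
Proof.
rewrite big_mkcond [in RHS]big_mkcond (bigD1 j)//= [in RHS](bigD1 j)//=.
rewrite ltnSn ltnn /= add0r addrC; congr (_ + _).
by apply: eq_bigr => h hj; rewrite ltnS leq_eqVlt (inj_eq val_inj) (negPf hj).
Qed.

(* Work done by time t, job j being run from a j to a j + p j. *)
Definition work {R : realType} {N : nat} (P : pred 'I_N) (a p : 'I_N -> R)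
    (t : R) : R :=
  \sum_(j < N | P j) (Num.min (a j + p j) t - Num.min (a j) t).

Definition disjoint_runs {R : realType} {N : nat} (P : pred 'I_N)
    (a p : 'I_N -> R) : Prop :=
  {in P &, forall i j, i != j -> a i + p i <= a j \/ a j + p j <= a i}.

Lemma work_lipschitz {R : realType} {N : nat} (P : pred 'I_N)
    (a p : 'I_N -> R) (x y : R) :
  (forall j, 0 < p j) -> disjoint_runs P a p -> x <= y ->
  work P a p y <= work P a p x + (y - x).
Proof.
move=> p0 dis xy; rewrite /work -!(big_filter _ P).
apply: (disjoint_work_lipschitz a (fun j => a j + p j)) => //.
- by rewrite filter_uniq// index_enum_uniq.
- by move=> j _; rewrite lerDl ltW.
- move=> j j'; rewrite !mem_filter => /andP[Pj _] /andP[Pj' _]; exact: dis.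
Qed.

Lemma work_end {R : realType} {N : nat} (P : pred 'I_N)
    (a p : 'I_N -> R) (t : R) :
  (forall j, 0 < p j) -> (forall j, P j -> a j + p j <= t) ->
  work P a p t = \sum_(j < N | P j) p j.
Proof.
move=> p0 bt; apply: eq_bigr => j /bt bjt; have pj := p0 j.
by rewrite !min_l//; lra.
Qed.

(** Work grows at most at unit rate, while H - t falls at unit rate and a positive q * load at rate
    at least q >= 1. *)
Lemma potential_decay {R : realType} {N : nat} {T : finType} (P : pred 'I_N)
    (a p : 'I_N -> R) (q : R) (G : {set T}) (C : T -> R) (H B t t' : R) :
  1 <= q -> (forall j, 0 < p j) -> disjoint_runs P a p ->
  (forall j, P j -> a j + p j <= H) -> t <= t' ->
  work P a p t + Num.max (H - t) (q * load G C t) <= B ->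
  work P a p t' + Num.max (H - t') (q * load G C t') <= B.
Proof.
move=> q1 p0 dis bH tt' pot.
have lip := work_lipschitz P a p t t' p0 dis tt'.
have maxH : H - t <= Num.max (H - t) (q * load G C t) by rewrite le_max lexx.
have maxL : q * load G C t <= Num.max (H - t) (q * load G C t).
  by rewrite le_max lexx orbT.
have L0 : 0 <= q * load G C t by rewrite mulr_ge0 ?load_ge0//; lra.
have := load_ge0 G C t'; rewrite le_eqVlt => /predU1P[<-|pos]; last first.
  have dec := load_decay G C t t' tt' pos.
  rewrite -lerBrDl ge_max; apply/andP; split; first lra.
  have : q * (load G C t' + (t' - t)) <= q * load G C t.
    by rewrite ler_wpM2l//; lra.
  nra.
rewrite mulr0; have [Ht'|Ht'] := leP t' H; first by rewrite max_l; lra.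
rewrite max_r; last lra.
(* All runs end by H < t', so the work at t' equals that at [Num.max H t], where the maximum covers
   a t beyond H. *)
have tH : t <= Num.max H t by rewrite le_max lexx orbT.
have := work_lipschitz P a p t (Num.max H t) p0 dis tH.
rewrite (work_end P a p t') ?(work_end P a p (Num.max H t))//.
- by case: (leP H t); lra.
- by move=> j /bH; rewrite le_max => ->.
- by move=> j /bH; lra.
Qed.

Definition accepted_in {R : realType} {m i : nat} (q : R) (grp : 'I_m -> 'I_i)
    (J : seq (job R)) (g : 'I_i) (j : 'I_(size J)) : bool :=
  if place q grp (completion q grp (take j J)) (job_at j) is Some k
  then grp k == g else false.

Lemma rejected_place {R : realType} {m i : nat} (q : R) (grp : 'I_m -> 'I_i)
    (J : seq (job R)) (j : 'I_(size J)) :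
  rejected (run (best_fit_rule q grp) J) j
    = ~~ isSome (place q grp (completion q grp (take j J)) (job_at j)).
Proof. by rewrite /rejected /run /best_fit_rule; case: place. Qed.

(* H bounds the completion times of the jobs of P revealed so far. A rejection
   extends it to at most t + q * load, so the maximum pays for it in advance. *)
Lemma potential_bound {R : realType} {m i : nat} (eps q : R)
    (grp : 'I_m -> 'I_i) (J : seq (job R)) (g : 'I_i) (P : pred 'I_(size J))
    (a : 'I_(size J) -> R) (n : nat) (t : R) :
  0 < eps -> 2 <= q -> (1 + eps) / eps <= q ^+ #|group grp g| ->
  group grp g != set0 -> valid_instance eps J ->
  (forall j, P j -> rejected (run (best_fit_rule q grp) J) j) ->
  (forall j, P j -> release (job_at j) <= a j) ->
  (forall j, P j -> a j + proc (job_at j) <= deadline (job_at j)) ->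
  disjoint_runs P a (fun j => proc (job_at j)) ->
  (n <= size J)%N -> 0 <= t ->
  (forall j : 'I_(size J), (j < n)%N -> release (job_at j) <= t) ->
  exists2 H, forall j : 'I_(size J), (j < n)%N && P j ->
                a j + proc (job_at j) <= H &
    work (fun j : 'I_(size J) => (j < n)%N && P j) a
         (fun j => proc (job_at j)) t
      + Num.max (H - t)
          (q * load (group grp g) (completion q grp (take n J)) t)
    <= q * \sum_(j < size J | (j < n)%N && accepted_in q grp J g j)
             proc (job_at j).
Proof.
move=> eps0 q2 qk gN0 valid Prej Prel Pdl dis.
have p0 (j : 'I_(size J)) : 0 < proc (job_at j) by have [] := valid.1 j.
elim: n t => [|n IH] t nJ t0 rt.
  exists 0 => //.
  rewrite /work !big_pred0//= take0 mulr0 add0r sub0r.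
  have -> : load (group grp g) (completion q grp [::]) t = 0.
    by apply: big1 => k _ /=; rewrite max_l// subrr.
  by rewrite mulr0 ge_max oppr_le0 t0 lexx.
pose j := Ordinal nJ.
set r := release (job_at j).
have [r0 _ slack] := valid.1 j.
have rr (j' : 'I_(size J)) : (j' < n)%N -> release (job_at j') <= r.
  exact: (release_mono eps J j' j valid).
have [H bH pot] := IH r (ltnW nJ) r0 rr.
have bal := balanced_completion eps q grp J g n r q2 valid (ltnW nJ) r0 rr.
(* Job j cannot start before r, so it has done no work by then. *)
have workS : work (fun h : 'I_(size J) => (h < n.+1)%N && P h) a
               (fun h => proc (job_at h)) r
           = work (fun h : 'I_(size J) => (h < n)%N && P h) a
               (fun h => proc (job_at h)) r.
  rewrite /work (sum_ord_ltnS P _ j); case: ifP => [Pj|_]; last by rewrite addr0.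
  have arj := Prel j Pj; have pj := p0 j.
  by rewrite !min_r ?subrr ?addr0// -/r; rewrite -/r in arj; lra.
pose H' := Num.max H (deadline (job_at j)).
have bH' (h : 'I_(size J)) : (h < n.+1)%N && P h -> a h + proc (job_at h) <= H'.
  case/andP; rewrite ltnS leq_eqVlt => /predU1P[hn|hn] Ph; rewrite le_max.
    have hj : h = j by exact: ord_inj.
    by rewrite -hj Pdl ?orbT.
  by rewrite bH ?hn.
have disS : disjoint_runs (fun h : 'I_(size J) => (h < n.+1)%N && P h) a
              (fun h => proc (job_at h)).
  by move=> h h' /andP[_ Ph] /andP[_ Ph']; exact: dis.
have q1 : 1 <= q by lra.
(* It is enough to have the bound at r: [potential_decay] carries it to t. *)
suff [H1 bH1 pot1] : exists2 H1, forall h : 'I_(size J), (h < n.+1)%N && P h ->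
      a h + proc (job_at h) <= H1 &
    work (fun h : 'I_(size J) => (h < n.+1)%N && P h) a
         (fun h => proc (job_at h)) r
      + Num.max (H1 - r)
          (q * load (group grp g) (completion q grp (take n.+1 J)) r)
    <= q * \sum_(h < size J | (h < n.+1)%N && accepted_in q grp J g h)
             proc (job_at h).
  exists H1 => //.
  exact: (potential_decay _ _ _ _ _ _ _ _ r t q1 p0 disS bH1 (rt j (ltnSn n)) pot1).
rewrite (sum_ord_ltnS (accepted_in q grp J g) _ j).
rewrite (completion_take q grp J j) workS.
case E : (place q grp (completion q grp (take j J)) (job_at j)) => [k|].
  (* An accepted job is not in [P], so H stays. If g took it, q * load and the right side both grow
     by q * p. *)
  exists H.
    move=> h /andP[]; rewrite ltnS leq_eqVlt => /predU1P[hn|hn] Ph.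
      have hj : h = j by exact: ord_inj.
      by have := Prej h Ph; rewrite hj rejected_place E.
    by rewrite bH ?hn.
  rewrite /update E /accepted_in E load_assign; last exact: ltW.
  rewrite -/r -lerBrDl ge_max; move: pot; rewrite -lerBrDl ge_max.
  move=> /andP[potH potL].
  have [_|_] := eqVneq (grp k) g; last by rewrite !addr0 potH potL.
  have : 0 <= q * proc (job_at j) by rewrite mulr_ge0 ?(ltW (p0 j))//; lra.
  by rewrite !mulrDr => ?; apply/andP; split; lra.
exists H' => //.
rewrite /update E /accepted_in E addr0.
have slk : deadline (job_at j) - r
    < q * load (group grp g) (completion q grp (take n J)) r.
  by apply: (place_None eps q grp _ _ g eps0 _ qk slack gN0 bal E); lra.
apply: le_trans pot; rewrite lerD2l ge_max [X in _ && X]le_max lexx orbT andbT.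
rewrite /H' le_max; have [_|_] := leP H (deadline (job_at j)).
  by rewrite (ltW slk) orbT.
by rewrite lexx.
Qed.

Lemma rejected_le_group {R : realType} {m i : nat} (eps q : R)
    (grp : 'I_m -> 'I_i) (J : seq (job R)) (g : 'I_i) (P : pred 'I_(size J))
    (a : 'I_(size J) -> R) :
  0 < eps -> 2 <= q -> (1 + eps) / eps <= q ^+ #|group grp g| ->
  group grp g != set0 -> valid_instance eps J ->
  (forall j, P j -> rejected (run (best_fit_rule q grp) J) j) ->
  (forall j, P j -> release (job_at j) <= a j) ->
  (forall j, P j -> a j + proc (job_at j) <= deadline (job_at j)) ->
  disjoint_runs P a (fun j => proc (job_at j)) ->
  \sum_(j < size J | P j) proc (job_at j)
    <= q * \sum_(j < size J | accepted_in q grp J g j) proc (job_at j).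
Proof.
move=> eps0 q2 qk gN0 valid Prej Prel Pdl dis.
have p0 (j : 'I_(size J)) : 0 < proc (job_at j) by have [] := valid.1 j.
(* The default 0 of the maximum provides t >= 0. *)
pose t : R := \big[Num.max/0]_(j < size J) deadline (job_at j).
have dt (j : 'I_(size J)) : deadline (job_at j) <= t by exact: le_bigmax.
have t0 : 0 <= t by exact: bigmax_ge_id.
have rt (j : 'I_(size J)) : release (job_at j) <= t.
  have [_ pj sj] := valid.1 j; have := dt j.
  by have := mulr_gt0 eps0 pj; lra.
have [H _] := potential_bound eps q grp J g P a (size J) t eps0 q2 qk gN0 valid
  Prej Prel Pdl dis (leqnn _) t0 (fun j _ => rt j).
rewrite (work_end _ _ _ _ p0); last first.
  by move=> j /andP[_ Pj]; exact: le_trans (Pdl j Pj) (dt j).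
under eq_bigl => j do rewrite ltn_ord.
under [in X in _ <= X -> _]eq_bigl => j do rewrite ltn_ord.
apply: le_trans; rewrite lerDl le_max; apply/orP; right.
by rewrite mulr_ge0 ?load_ge0//; lra.
Qed.

(** * From one machine to the competitive ratio *)

(** Two overlapping runs would both be in process at the later of their starting times. *)
Lemma disjoint_runs_feasible {R : realType} {m : nat} (J : seq (job R))
    (S : schedule m J) (k : 'I_m) (P : pred 'I_(size J))
    (a : 'I_(size J) -> R) :
  (forall j : 'I_(size J), 0 < proc (job_at j)) -> feasible S ->
  (forall j, P j -> S j = Some (k, a j)) ->
  disjoint_runs P a (fun j => proc (job_at j)).
Proof.
move=> p0 [_ excl] PS j j' Pj Pj' jj'.
have [?|lt1] := leP (a j + proc (job_at j)) (a j'); first by left.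
have [?|lt2] := leP (a j' + proc (job_at j')) (a j); first by right.
have pj := p0 j; have pj' := p0 j'.
case/eqP: jj'; apply: (excl k (Num.max (a j) (a j'))).
  exists (a j); first exact: PS.
  by rewrite le_max lexx gt_max lt1 ltrDl pj.
exists (a j'); first exact: PS.
by rewrite le_max lexx orbT gt_max lt2 ltrDl pj'.
Qed.

(** [L] is the average number m / i of machines per group; each single group has to be nonempty and
    large enough for the power of q to reach (1 + eps) / eps. *)
Lemma best_fit_competitive {R : realType} {m i : nat} (eps q L : R)
    (grp : 'I_m -> 'I_i) :
  0 < eps -> 2 <= q -> (0 < i)%N -> m%:R = i%:R * L -> 0 <= L ->
  (forall g, group grp g != set0) ->
  (forall g, (1 + eps) / eps <= q ^+ #|group grp g|) ->
  strict_competitive_ratio_le eps (best_fit_rule q grp) (q * L + 1).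
Proof.
move=> eps0 q2 i0 defm L0 gN0 qk J valid.
have p0 (j : 'I_(size J)) : 0 < proc (job_at j) by have [] := valid.1 j.
set rule := best_fit_rule q grp.
have ALG_E : ALG rule J
    = \sum_(j < size J | ~~ rejected (run rule J) j) proc (job_at j).
  rewrite /ALG /objective [RHS]big_mkcond; apply: eq_bigr => j _.
  by case: rejected; rewrite /= ?subrr ?mulr0 ?subr0 ?mulr1.
have ALG_ge0 : 0 <= ALG rule J.
  by rewrite ALG_E; apply: sumr_ge0 => j _; exact: ltW.
have ALG_groups : ALG rule J
    = \sum_(g < i) \sum_(j < size J | accepted_in q grp J g j) proc (job_at j).
  rewrite ALG_E (exchange_big_dep predT)//= big_mkcond; apply: eq_bigr => j _.
  rewrite rejected_place /accepted_in; case: place => [k|] /=.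
    by rewrite (big_pred1 (grp k))// => g; rewrite eq_sym.
  by rewrite big_pred0.
have qL0 : 0 <= q * L by rewrite mulr_ge0//; lra.
apply: bigmax_le => [|A /asboolP[S [feasS AS]]].
  by rewrite mulr_ge0// addr_ge0.
pose on (k : 'I_m) (j : 'I_(size J)) :=
  if S j is Some (k', _) then k' == k else false.
(* The value 0 is a dummy: [a] is used only for jobs on some machine. *)
pose a (j : 'I_(size J)) := if S j is Some (_, t) then t else 0.
have onS k j : on k j -> S j = Some (k, a j).
  by rewrite /on /a; case: (S j) => [[k' t]|//] /eqP ->.
pose Rej := \sum_(j < size J | (j \in A) && rejected (run rule J) j) proc (job_at j).
have Rej_E : Rej = \sum_(k < m) \sum_(j < size J | rejected (run rule J) j && on k j)
                     proc (job_at j).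
  rewrite /Rej (exchange_big_dep predT)//= big_mkcond [RHS]big_mkcond.
  apply: eq_bigr => j _; rewrite AS /rejected /on.
  case: (S j) => [[k t]|] /=; last first.
    by rewrite big_pred0// => k; rewrite andbF.
  case: (isSome (run rule J j)) => /=; first by rewrite big_pred0.
  by rewrite (big_pred1 k)// => k'; rewrite eq_sym.
have Rej_group g : Rej <= m%:R * (q * \sum_(j < size J | accepted_in q grp J g j)
                                       proc (job_at j)).
  have sum_m (x : R) : m%:R * x = \sum_(k < m) x.
    by rewrite sumr_const card_ord mulr_natl.
  rewrite Rej_E sum_m; apply: ler_sum => k _.
  apply: (rejected_le_group eps _ _ _ _ _ a) => //.
  - by move=> j /andP[].
  - by move=> j /andP[_ /onS Sj]; have [] := feasS.1 j k (a j) Sj.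
  - by move=> j /andP[_ /onS Sj]; have [] := feasS.1 j k (a j) Sj.
  - by apply: (disjoint_runs_feasible _ S k) => // j /andP[_ /onS].
(* Each group alone bounds [Rej]. Adding the i bounds gives i * Rej <= m * q * ALG, and m = i * L
   lets i cancel. *)
have Rej_le : Rej <= q * L * ALG rule J.
  have i0' : 0 < i%:R :> R by rewrite ltr0n.
  rewrite -(ler_pM2l i0').
  have -> : i%:R * (q * L * ALG rule J) = m%:R * (q * ALG rule J).
    by rewrite defm; ring.
  have -> : i%:R * Rej = \sum_(g < i) Rej.
    by rewrite sumr_const card_ord mulr_natl.
  rewrite ALG_groups !mulr_sumr; apply: ler_sum => g _; exact: Rej_group.
have -> : \sum_(j in A) proc (job_at j) = Rej
    + \sum_(j < size J | (j \in A) && ~~ rejected (run rule J) j) proc (job_at j).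
  by rewrite (bigID (rejected (run rule J))).
rewrite mulrDl mul1r lerD// ALG_E [leRHS]big_mkcond [leLHS]big_mkcond.
apply: ler_sum => j _; case: (j \in A) => //=; case: ifP => // _.
exact: ltW.
Qed.

(** * Cutting the machines into groups *)

Theorem corollary1 (R : realType) (eps : R) (m i : nat)
    (eps_gt0 : 0 < eps) (eps_le1 : eps <= 1)
    (ln_int : ln ((1 + eps) / eps) \is a Num.int)
    (i_gt0 : (0 < i)%N)
    (m_def : m%:R = i%:R * ln ((1 + eps) / eps)) :
  exists A : online_rule R m,
    online_algorithm eps A /\
    strict_competitive_ratio_le eps A (expR 1 * ln ((1 + eps) / eps) + 1).
Proof.
have ratio_gt1 : 1 < (1 + eps) / eps by rewrite ltr_pdivlMr// mul1r ltrDr.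
have L_gt0 : 0 < ln ((1 + eps) / eps) by exact: ln_gt0.
have /natrP[k Lk] : ln ((1 + eps) / eps) \is a Num.nat.
  by rewrite natrEint ln_int ltW.
have k_gt0 : (0 < k)%N by rewrite -(ltr0n R) -Lk.
have mE : m = (i * k)%N.
  by apply/eqP; rewrite -(eqr_nat R) m_def Lk natrM.
subst m.
(* Machines are numbered as the entries of an i by k matrix; the group is the row. *)
pose grp (h : 'I_(i * k)) : 'I_i :=
  (enum_val (cast_ord (esym (mxvec_cast i k)) h)).1.
have group_ge g : (k <= #|group grp g|)%N.
  rewrite -[leqLHS]card_ord -(card_imset _ (f := mxvec_index g)); last first.
    by move=> x y /cast_ord_inj/enum_rank_inj[].
  apply/subset_leq_card/subsetP => h /imsetP[x _ ->].
  by rewrite inE /grp /mxvec_index cast_ordK enum_rankK.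
have e_ge2 : 2 <= expR 1 :> R by have := expR_ge1Dx (1 : R); lra.
exists (best_fit_rule (expR 1) grp); split; first exact: best_fit_online.
apply: best_fit_competitive => //; first exact: ltW.
- by move=> g; rewrite -card_gt0 (leq_trans k_gt0).
(* Since k = ln ((1 + eps) / eps), e ^ k is exactly (1 + eps) / eps. *)
- move=> g; apply: (@le_trans _ _ (expR 1 ^+ k)).
    by rewrite -expRM_natr mul1r -Lk lnK// posrE; lra.
  by rewrite ler_weXn2l ?group_ge//; lra.
Qed.
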